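(* Consider a quadratic non-overlapping configuration of rank $r\ge48$ with column widths $q_1\ge q_2\ge q_3$ and dimension $\Delta\le\frac r3-12$. Then $(n_1,n_2)\in\{(2,2),(3,3),(2,4),(2,3)\}$ and $|c_i|\le n_i$ for $i=1,2$.
   Context: A quadratic non-overlapping configuration of rank $r$ with sign $\varepsilon\in\{1,-1\}$ consists of: integers $q_1\ge q_2\ge q_3\ge1$ with $q_1+q_2+q_3=r$; for each $i\in\{1,2,3\}$, a finite collection of positive integers (parts) $\lambda_i^0,\dots,\lambda_i^{s_i}$ with $\sum_j\lambda_i^j=r$ and $\lambda_i^j\le q_i$; and an assignment to each part of a type $e$ or $f$. The type $e$ parts of column $i$ in decreasing order are $e_i^0\ge e_i^1\ge\cdots$, and the type $f$ parts $f_i^0\ge f_i^1\ge\cdots$. The dimension is $\Delta=\beta-\varepsilon l$ with $\beta=r^2-\sum_{i,j}(\lambda_i^j)^2$ and $l=r-\sum_{i,j}(-1)^je_i^j-\sum_{i,j}(-1)^jf_i^j$. For each $i$, the integers $n_i,c_i$ are defined by $r=n_iq_i+c_i$ with $-\frac{q_i}2<c_i\le\frac{q_i}2$. *)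

(* Defs.v *)
From HB Require Import structures.
From mathcomp Require Import all_boot all_order all_algebra.
From mathcomp Require Import zify ring lra.

Set Implicit Arguments.
Unset Strict Implicit.
Unset Printing Implicit Defensive.

Import Order.TTheory GRing.Theory Num.Theory.

Local Open Scope ring_scope.

Inductive part_type := TypeE | TypeF.

Definition is_typeE (t : part_type) : bool :=
  if t is TypeE then true else false.

Definition is_typeF (t : part_type) : bool :=
  if t is TypeF then true else false.

Definition column1 : 'I_3 := @Ordinal 3 0 isT.
Definition column2 : 'I_3 := @Ordinal 3 1 isT.
Definition column3 : 'I_3 := @Ordinal 3 2 isT.

(* A column is listed as a sequence of (part, type) pairs.  The order of the
   list carries no information: the sequences e_i^j and f_i^j are obtained by
   sorting the parts of each type. *)
Record qno_config (r : nat) := QnoConfig {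
  width : 'I_3 -> nat;
  parts : 'I_3 -> seq (nat * part_type);
  width_ge12 : (width column2 <= width column1)%N;
  width_ge23 : (width column3 <= width column2)%N;
  width3_ge1 : (1 <= width column3)%N;
  width_sum : (\sum_(i < 3) width i)%N = r;
  parts_pos : forall i, all (fun p => 0 < p.1)%N (parts i);
  parts_sum : forall i, (\sum_(p <- parts i) p.1)%N = r;
  parts_le_width : forall i, all (fun p => p.1 <= width i)%N (parts i)
}.

Definition e_parts (r : nat) (C : qno_config r) (i : 'I_3) : seq nat :=
  sort geq [seq p.1 | p <- parts C i & is_typeE p.2].

Definition f_parts (r : nat) (C : qno_config r) (i : 'I_3) : seq nat :=
  sort geq [seq p.1 | p <- parts C i & is_typeF p.2].

Definition beta (r : nat) (C : qno_config r) : int :=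
  (r ^ 2)%N%:Z - \sum_(i < 3) \sum_(p <- parts C i) (p.1 ^ 2)%N%:Z.

Definition ell (r : nat) (C : qno_config r) : int :=
  r%:Z
  - \sum_(i < 3) \sum_(j < size (e_parts C i))
      (-1) ^+ j * (nth 0%N (e_parts C i) j)%:Z
  - \sum_(i < 3) \sum_(j < size (f_parts C i))
      (-1) ^+ j * (nth 0%N (f_parts C i) j)%:Z.

Definition dimension (r : nat) (C : qno_config r) (eps : int) : int :=
  beta C - eps * ell C.

Definition centered_division (r q : nat) (n c : int) : Prop :=
  [/\ r%:Z = n * q%:Z + c,
      - (q%:R / 2%:R) < c%:~R :> rat &
      c%:~R <= q%:R / 2%:R :> rat].

Lemma centered_division_exists_unique (r q : nat) (hq : (0 < q)%N) :
  exists! nc : int * int, centered_division r q nc.1 nc.2.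
Proof.
have E (n c : int) : centered_division r q n c <->
    [/\ r%:Z = n * q%:Z + c, - q%:Z < 2 * c & 2 * c <= q%:Z].
  have H1 : (- (q%:R / 2%:R) < c%:~R :> rat) = (- q%:Z < 2 * c).
    rewrite -(ltr_int rat) rmorphN rmorphM /= -pmulrn; apply/idP/idP; lra.
  have H2 : (c%:~R <= q%:R / 2%:R :> rat) = (2 * c <= q%:Z).
    rewrite -(ler_int rat) rmorphM /= -pmulrn; apply/idP/idP; lra.
  by rewrite /centered_division H1 H2.
have [n [t [Hm Ht]]] :
    exists n t : nat, (2 * r + q - 1 = n * (2 * q) + t)%N /\ (t < 2 * q)%N.
  exists ((2 * r + q - 1) %/ (2 * q))%N, ((2 * r + q - 1) %% (2 * q))%N.
  by rewrite -divn_eq ltn_mod; split => //; lia.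
exists (n%:Z, r%:Z - n%:Z * q%:Z); split => [|[n' c'] /E /= [h1 h2 h3]].
  by apply/E; split => /=; nia.
have Hn : n' = n%:Z by nia.
by rewrite Hn in h1 *; congr pair; lia.
Qed.

(* Main.v *)
(* Since q_1 + q_2 + q_3 = r, the dimension is a sum over the columns of
   sum_j lambda (q_i - lambda) - eps l_i, where l_i is q_i minus the alternating
   sums of the e_i and of the f_i.  Here |l_i| <= q_i, and the defect
   sum_j lambda (q_i - lambda) is at least |c_i| (q_i - |c_i|).  Hence
   sum_i |c_i| (q_i - |c_i|) <= 4r/3 - 12, which forces the conclusion for all
   widths except r = 50, q = (25, 15, 10).  There the third column has odd
   n_3 = 5 and c_3 = 0, and the bound -q_3 on its contribution improves to 0. *)
Require Import Defs.
From HB Require Import structures.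
From mathcomp Require Import all_boot all_order all_algebra.
From mathcomp Require Import zify ring lra.

Set Implicit Arguments.
Unset Strict Implicit.
Unset Printing Implicit Defensive.

Import Order.TTheory GRing.Theory Num.Theory.

Local Open Scope ring_scope.

(** * Alternating sums and defects of lists of parts *)

Definition alternating_sum (s : seq nat) : int :=
  \sum_(j < size s) (-1) ^+ j * (nth 0%N s j)%:Z.

Lemma alternating_sum_nil : alternating_sum [::] = 0.
Proof. exact: big_ord0. Qed.

Lemma alternating_sum_cons (x : nat) (s : seq nat) :
  alternating_sum (x :: s) = x%:Z - alternating_sum s.
Proof.
rewrite /alternating_sum big_ord_recl expr0 mul1r -sumrN; congr (_ + _).
by apply: eq_bigr => j _; rewrite exprS mulN1r mulNr.
Qed.

(** By induction the tail's alternating sum lies between 0 and the head x, hence so does x minus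
    it. *)
Lemma alternating_sum_sorted_bounds (q : nat) (s : seq nat) :
  path geq q s -> 0 <= alternating_sum s <= q%:Z.
Proof.
elim: s q => [|x s IHs] q /=; first by rewrite alternating_sum_nil.
by case/andP=> qx /IHs; rewrite alternating_sum_cons /= in qx *; lia.
Qed.

Lemma alternating_sum_sort_bounds (q : nat) (s : seq nat) :
  all (fun x => (x <= q)%N) s -> 0 <= alternating_sum (sort geq s) <= q%:Z.
Proof.
move=> sq; apply: alternating_sum_sorted_bounds.
rewrite path_min_sorted; last by rewrite all_sort.
by apply: sort_sorted => x y; exact: leq_total.
Qed.

Lemma alternating_sum_nseq (k x : nat) :
  alternating_sum (nseq k x) = (odd k * x)%N%:Z.
Proof.
elim: k => [|k IHk] /=; first by rewrite alternating_sum_nil mul0n.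
by rewrite alternating_sum_cons IHk; case: (odd k) => /=; lia.
Qed.

(* The periodic extension of x (q - x) from [0, q] is subadditive. *)
Lemma defect_lower_bound (q : nat) (s : seq nat) (m t : int) :
  all (fun x => (x <= q)%N) s ->
  (\sum_(x <- s) x)%N%:Z = m * q%:Z + t -> 0 <= t <= q%:Z ->
  t * (q%:Z - t) <= \sum_(x <- s) x%:Z * (q%:Z - x%:Z).
Proof.
elim: s m t => [|x s IHs] m t /=.
  rewrite !big_nil => _ E /andP[t0 tq].
  have [->|->] : t = 0 \/ t = q%:Z.
    have [m0|] : m = 0 \/ (m <= -1 \/ 1 <= m) by lia.
      by left; rewrite m0 in E; lia.
    by case=> hm; nia.
  - by rewrite mul0r.
  - by rewrite subrr mulr0.
case/andP=> xq sq; rewrite !big_cons PoszD => E /andP[t0 tq].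
have [xt|tx] := lerP x%:Z t.
  have I := IHs m (t - x%:Z) sq ltac:(lia) ltac:(lia).
  (* Half the slack in the subadditivity at x and t - x. *)
  have P : 0 <= x%:Z * (t - x%:Z) by apply: mulr_ge0; lia.
  by move: (\sum_(j <- s) _) I => S I; clear - I P; lia.
have m1 : 1 <= m by nia.
(* One q is borrowed from m; half the slack is now (q - x)(x - t). *)
have I := IHs (m - 1) (t + q%:Z - x%:Z) sq ltac:(lia) ltac:(lia).
have P : 0 <= (q%:Z - x%:Z) * (x%:Z - t) by apply: mulr_ge0; lia.
by move: (\sum_(j <- s) _) I => S I; clear - I P; lia.
Qed.

(** * Contributions of the columns to the dimension *)

Definition part_sizes (r : nat) (C : qno_config r) (i : 'I_3) : seq nat :=
  [seq p.1 | p <- parts C i].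

Lemma part_sizes_sum (r : nat) (C : qno_config r) (i : 'I_3) :
  (\sum_(x <- part_sizes C i) x)%N = r.
Proof. by rewrite big_map parts_sum. Qed.

Lemma part_sizes_le_width (r : nat) (C : qno_config r) (i : 'I_3) :
  all (fun x => (x <= width C i)%N) (part_sizes C i).
Proof. by rewrite all_map; exact: parts_le_width. Qed.

Lemma part_sizes_gt0 (r : nat) (C : qno_config r) (i : 'I_3) :
  all (fun x => (0 < x)%N) (part_sizes C i).
Proof. by rewrite all_map; exact: parts_pos. Qed.

Definition column_defect (r : nat) (C : qno_config r) (i : 'I_3) : int :=
  \sum_(x <- part_sizes C i) x%:Z * ((width C i)%:Z - x%:Z).

Definition column_ell (r : nat) (C : qno_config r) (i : 'I_3) : int :=
  (width C i)%:Z - alternating_sum (e_parts C i) - alternating_sum (f_parts C i).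

Lemma dimension_columns (r : nat) (C : qno_config r) (eps : int) :
  dimension C eps = \sum_(i < 3) (column_defect C i - eps * column_ell C i).
Proof.
have width_sumz : \sum_(i < 3) (width C i)%:Z = r%:Z.
  by rewrite -[RHS](congr1 Posz (width_sum C)) (big_morph _ PoszD (erefl 0%:Z)).
rewrite big_split /= sumrN -mulr_sumr; congr (_ - _ * _); last first.
  by rewrite /column_ell !big_split /= !sumrN width_sumz.
(* One factor of r^2 becomes the sum of the widths, the other the sum of the parts of column i. *)
rewrite /beta -mulnn PoszM -[in X in X * _]width_sumz mulr_suml -sumrB.
apply: eq_bigr => i _.
have <- : \sum_(x <- part_sizes C i) x%:Z = r%:Z.
  by rewrite -[RHS](congr1 Posz (part_sizes_sum C i))
    (big_morph _ PoszD (erefl 0%:Z)).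
rewrite mulr_sumr -(big_map fst xpredT (fun x => (x ^ 2)%N%:Z)) -sumrB.
by apply: eq_bigr => x _; rewrite -mulnn PoszM; ring.
Qed.

Lemma column_ell_bounds (r : nat) (C : qno_config r) (i : 'I_3) :
  - (width C i)%:Z <= column_ell C i <= (width C i)%:Z.
Proof.
have le_width (a : pred (nat * part_type)) :
    all (fun x => (x <= width C i)%N) [seq p.1 | p <- parts C i & a p].
  rewrite all_map all_filter; apply: sub_all (parts_le_width C i) => p /= ->.
  by rewrite implybT.
have := alternating_sum_sort_bounds (le_width (fun p => is_typeE p.2)).
have := alternating_sum_sort_bounds (le_width (fun p => is_typeF p.2)).
rewrite -/(e_parts C i) -/(f_parts C i) /column_ell; lia.
Qed.

Lemma column_defect_lower_bound (r : nat) (C : qno_config r) (i : 'I_3)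
    (m t : int) :
  r%:Z = m * (width C i)%:Z + t -> 0 <= t <= (width C i)%:Z ->
  t * ((width C i)%:Z - t) <= column_defect C i.
Proof.
move=> E tq; apply: (defect_lower_bound (part_sizes_le_width C i) _ tq).
by rewrite part_sizes_sum; exact: E.
Qed.

Lemma column_defect_ge0 (r : nat) (C : qno_config r) (i : 'I_3) :
  0 <= column_defect C i.
Proof.
rewrite /column_defect big_seq; apply: sumr_ge0 => x.
by move/(allP (part_sizes_le_width C i)) => /= le_xq; apply: mulr_ge0; lia.
Qed.

(* If all parts equal q then l_i = 0, because exactly one of the two types has
   an odd number of parts; otherwise a part x <> q and the parts making up r - x
   each contribute at least q - 1 to the defect. *)
Lemma odd_quotient_column_ge0 (r : nat) (C : qno_config r) (i : 'I_3)
    (k : nat) (eps : int) :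
  eps = 1 \/ eps = -1 -> odd k -> r = (k * width C i)%N ->
  (2 <= width C i)%N -> 0 <= column_defect C i - eps * column_ell C i.
Proof.
move=> heps odd_k rE q2; set q := width C i in rE q2 *.
have [all_q|] := boolP (all (pred1 q) (part_sizes C i)).
  suff : column_ell C i = 0 by have := column_defect_ge0 C i; case: heps => ->; lia.
  have sort_nseq (a : pred (nat * part_type)) :
      sort geq [seq p.1 | p <- parts C i & a p] = nseq (count a (parts C i)) q.
    have /all_pred1P-> : all (pred1 q) [seq p.1 | p <- parts C i & a p].
      rewrite all_map all_filter; move: all_q; rewrite all_map.
      by apply: sub_all => p /= ->; rewrite implybT.
    rewrite size_map size_filter; apply: sorted_sort.
      by move=> x y z /= h1 h2; exact: leq_trans h2 h1.
    by elim: (count _ _) => //= - [|n] //= ->; rewrite leqnn.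
  have sizeE : size (parts C i) = k.
    have := part_sizes_sum C i; rewrite (all_pred1P _ _ all_q) size_map.
    rewrite big_nseq iter_addn_0 => qk; apply/eqP.
    by rewrite -(eqn_pmul2l (ltnW q2)) qk mulnC -rE.
  have countE : (count (fun p => is_typeE p.2) (parts C i)
                 + count (fun p => is_typeF p.2) (parts C i))%N = k.
    rewrite -sizeE -(count_predC (fun p => is_typeE p.2)); congr addn.
    by apply: eq_count => -[x []].
  rewrite /column_ell /e_parts /f_parts !sort_nseq !alternating_sum_nseq -/q.
  rewrite -countE oddD in odd_k.
  by case: odd odd_k; case: odd => // _ /=; lia.
rewrite -has_predC => /hasP[x x_in /= xq].
have x_le := allP (part_sizes_le_width C i) x x_in.
have x_gt := allP (part_sizes_gt0 C i) x x_in.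
rewrite /= -/q in x_le x_gt xq.
have [s1 [s2 sE]] : exists s1 s2, part_sizes C i = s1 ++ x :: s2.
  by case/splitPr: x_in => s1 s2; exists s1, s2.
have rest_le : all (fun y => (y <= q)%N) (s1 ++ s2).
  have := part_sizes_le_width C i; rewrite sE !all_cat /= -/q.
  by case/and3P=> -> _ ->.
have rest_sum : (\sum_(y <- s1 ++ s2) y)%N%:Z
    = (k%:Z - 1) * q%:Z + (q%:Z - x%:Z).
  have := part_sizes_sum C i; rewrite sE !big_cat big_cons /= -/q; lia.
have R := defect_lower_bound rest_le rest_sum ltac:(lia).
have dE : column_defect C i = x%:Z * (q%:Z - x%:Z)
    + \sum_(y <- s1 ++ s2) y%:Z * (q%:Z - y%:Z).
  by rewrite /column_defect sE !big_cat big_cons /= -/q; ring.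
(* This says x (q - x) >= q - 1, so the defect is at least 2 (q - 1) >= q. *)
have P : 0 <= (x%:Z - 1) * (q%:Z - 1 - x%:Z) by apply: mulr_ge0; lia.
have := column_ell_bounds C i; rewrite -/q dE.
move: R P; move: (\sum_(y <- _) _) => S R P.
by case: heps => ->; lia.
Qed.

(** * Integer inequalities for quotients and remainders *)

Definition dominates_defect (r q b : int) := forall m t : int,
  r = m * q + t -> 0 <= t <= q -> t * (q - t) <= b.

(** For c < 0 take t = q + c: the product t (q - t) is symmetric under t -> q - t. *)
Lemma dominates_defect_abs (r q b n c : int) : dominates_defect r q b ->
  r = n * q + c -> - q <= c <= q -> `|c| * (q - `|c|) <= b.
Proof.
move=> B E cq; have [c0|c0] := lerP 0 c.
  have := B n c; rewrite ger0_norm //; lia.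
have := B (n - 1) (q + c); rewrite ltr0_norm //; nia.
Qed.

(* The lower bound on b is concave in |c|, so a violation is refuted from its
   values at the ends t0 and r / k of the range of |c|, that is, from
   (|c| - t0) * (r - k * |c|) >= 0. *)
Lemma quotient2_small_remainder (r q b c : int) : 48 <= r ->
  dominates_defect r q b -> r = 2 * q + c -> - q < 2 * c <= q ->
  3 * b <= 4 * r - 36 -> `|c| <= 2.
Proof.
move=> hr B E cq hb.
have D := dominates_defect_abs B E ltac:(lia).
rewrite leNgt; apply/negP => h.
have [c0|c0] := lerP 0 c.
  rewrite ger0_norm // in h D.
  (* In general r = n q + c and 2 |c| <= q give r >= (2n + 1) c for c >= 0 and r >= (2n - 1) |c| for
     c < 0. *)
  have P : 0 <= (c - 3) * (r - 5 * c) by apply: mulr_ge0; lia.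
  nia.
rewrite ltr0_norm // in h D.
have P : 0 <= (- c - 3) * (r + 3 * c) by apply: mulr_ge0; lia.
nia.
Qed.

(** A nonzero c_1 uses up about r/2 of the budget 4r/3 - 12. The cheapest case is c = 1, with q - 1
    = (r - 3)/2. *)
Lemma quotient2_nonzero_remainder (r q b c : int) : 48 <= r ->
  dominates_defect r q b -> r = 2 * q + c -> c != 0 -> `|c| <= 2 ->
  r - 3 <= 2 * b.
Proof.
move=> hr B E c0 c2.
have D := dominates_defect_abs B E ltac:(lia).
have [a1|a2] : `|c| = 1 \/ `|c| = 2 by lia.
  by rewrite a1 in D; lia.
by rewrite a2 in D; lia.
Qed.

(** One-sided, because c = -4 costs 4 (q - 4) = (4r - 32)/3, just over the budget, while c = 4 costs
    only (4r - 64)/3. *)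
Lemma quotient3_remainder_ge (r q b c : int) : 48 <= r ->
  dominates_defect r q b -> r = 3 * q + c -> - q < 2 * c <= q ->
  3 * b <= 4 * r - 36 -> -3 <= c.
Proof.
move=> hr B E cq hb.
have D := dominates_defect_abs B E ltac:(lia).
rewrite leNgt; apply/negP => h.
rewrite ltr0_norm in D; last lia.
have P : 0 <= (- c - 4) * (r + 5 * c) by apply: mulr_ge0; lia.
nia.
Qed.

Lemma first_quotient (r q1 q2 q3 n c b : int) : 48 <= r ->
  q2 <= q1 -> q3 <= q2 -> 1 <= q3 -> q1 + q2 + q3 = r ->
  dominates_defect r q1 b -> r = n * q1 + c -> - q1 < 2 * c <= q1 ->
  3 * b <= 4 * r - 36 -> n = 2 \/ n = 3.
Proof.
move=> hr h12 h23 h3 hs B E cq hb.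
have n1 : 1 <= n by nia.
have n4 : n <= 3 by nia.
have [n_eq|//] : n = 1 \/ (n = 2 \/ n = 3) by lia.
have D := dominates_defect_abs B E ltac:(lia).
subst n; rewrite ger0_norm in D; last lia.
(* With n = 1, c = q2 + q3 >= 2. *)
have P : 0 <= (c - 2) * (r - 3 * c) by apply: mulr_ge0; lia.
nia.
Qed.

(** As q1 >= r/3, c1 <= 0 and q1 <= r/3 + 1. Then (r - q1)/2 <= q2 <= q1 puts q2 between r/3 - 1/2
    and r/3 + 1. *)
Lemma remainders_le_quotient33 (r q1 q2 q3 n2 c1 c2 : int) : 48 <= r ->
  q2 <= q1 -> q3 <= q2 -> q1 + q2 + q3 = r ->
  r = 3 * q1 + c1 -> -3 <= c1 ->
  r = n2 * q2 + c2 -> - q2 < 2 * c2 <= q2 ->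
  n2 = 3 /\ `|c1| <= 3 /\ `|c2| <= 3.
Proof.
move=> hr h12 h23 hs E1 c1l E2 c2q.
have n2l : 2 < n2 by nia.
have n2u : n2 < 4 by nia.
have n2E : n2 = 3 by lia.
subst n2; lia.
Qed.

(** The second column alone does not exclude c2 = 4, so another column must contribute: the first if
    c1 is nonzero, otherwise the third, where r = 6 q3 - 2 c2. *)
Lemma second_remainder_le_quotient23 (r q1 q2 q3 b1 b2 b3 c1 c2 : int) :
  48 <= r ->
  q1 + q2 + q3 = r ->
  dominates_defect r q1 b1 -> dominates_defect r q2 b2 ->
  dominates_defect r q3 b3 ->
  0 <= b1 -> 0 <= b2 -> 0 <= b3 ->
  r = 2 * q1 + c1 -> `|c1| <= 2 -> r = 3 * q2 + c2 -> - q2 < 2 * c2 <= q2 ->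
  3 * (b1 + b2 + b3) <= 4 * r - 36 ->
  ~ (q1 = 25 /\ q2 = 15 /\ q3 = 10) ->
  `|c2| <= 3.
Proof.
move=> hr hs B1 B2 B3 b10 b20 b30 E1 c1s E2 c2q hb exc.
have c2l : -3 <= c2 by apply: (@quotient3_remainder_ge r q2 b2) => //; lia.
suff : c2 <= 3 by lia.
rewrite leNgt; apply/negP => h.
have D2 := dominates_defect_abs B2 E2 ltac:(lia).
rewrite ger0_norm in D2; last lia.
(* With [D2] and [M] this yields 3 b2 >= 4r + 3 c2^2 - 28 c2, so [hb] leaves 3 (b1 + b3) <= 28 c2 -
   3 c2^2 - 36. *)
have P : 0 <= (c2 - 4) * (r - 7 * c2) by apply: mulr_ge0; lia.
have M : c2 * r = 3 * (c2 * q2) + c2 * c2 by rewrite [in LHS]E2; ring.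
have [c1E|c1N] := eqVneq c1 0; last first.
  have D1 := quotient2_nonzero_remainder hr B1 E1 c1N c1s.
  (* The integer 5 is nearest to 14/3, where 28 c2 - 3 c2^2 is largest. *)
  have S := sqr_ge0 (c2 - 5).
  clear - hr h P M D1 D2 S hb b30; lia.
have c2u : c2 <= 7.
  rewrite leNgt; apply/negP => c2g.
  have S : 0 <= (c2 - 8) * (3 * c2 - 4) by apply: mulr_ge0; lia.
  clear - hr P M D2 S hb b10 b30; lia.
have [c2E|[c2E|[c2E|c2E]]] : c2 = 4 \/ c2 = 5 \/ c2 = 6 \/ c2 = 7 by lia.
- subst c2 c1; have := B3 5 (q3 - 8); lia.
- subst c2 c1; have := B3 5 1; have := B3 5 2; lia.
- subst c2 c1; have := B3 4 8; have := B3 4 10; lia.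
- subst c2 c1; have := B3 4 8; lia.
Qed.

Lemma second_remainder_le_quotient24 (r q1 q2 q3 b1 b2 b3 c1 c2 : int) :
  48 <= r ->
  q3 <= q2 -> q1 + q2 + q3 = r ->
  dominates_defect r q1 b1 -> dominates_defect r q2 b2 ->
  dominates_defect r q3 b3 ->
  0 <= b1 -> 0 <= b2 -> 0 <= b3 ->
  r = 2 * q1 + c1 -> `|c1| <= 2 -> r = 4 * q2 + c2 -> - q2 < 2 * c2 <= q2 ->
  3 * (b1 + b2 + b3) <= 4 * r - 36 ->
  `|c2| <= 4.
Proof.
move=> hr h23 hs B1 B2 B3 b10 b20 b30 E1 c1s E2 c2q hb.
(* From q3 <= q2, r <= q1 + 2 q2, so c2 <= -c1 <= 2. *)
suff : -4 <= c2 by lia.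
rewrite leNgt; apply/negP => h.
have D2 := dominates_defect_abs B2 E2 ltac:(lia).
rewrite ltr0_norm in D2; last lia.
have P : 0 <= (- c2 - 5) * (r + 7 * c2) by apply: mulr_ge0; lia.
have M : c2 * r = 4 * (c2 * q2) + c2 * c2 by rewrite [in LHS]E2; ring.
have [c1E|c1N] := eqVneq c1 0; last first.
  have D1 := quotient2_nonzero_remainder hr B1 E1 c1N c1s.
  have S := sqr_ge0 (c2 + 5).
  clear - hr h P M D1 D2 S hb b30; lia.
(* Since c1 = 0, the remainders of the last two columns are opposite, and both columns pay about
   |c2| r/4. *)
have D3 := B3 4 (- c2) ltac:(lia) ltac:(lia).
have E3 : r = 4 * q3 - c2 by lia.
have M3 : c2 * r = 4 * (c2 * q3) - c2 * c2 by rewrite [in LHS]E3; ring.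
have S := sqr_ge0 (c2 + 6).
clear - hr h P M M3 D2 D3 S hb b10; lia.
Qed.

Theorem proposition4p12 (r : nat) (hr : (48 <= r)%N)
  (eps : int) (heps : eps = 1 \/ eps = -1)
  (C : qno_config r)
  (hdim : (dimension C eps)%:~R <= r%:R / 3%:R - 12%:R :> rat)
  (n c : 'I_3 -> int)
  (hnc : forall i : 'I_3, centered_division r (width C i) (n i) (c i)) :
  (n column1, n column2) \in
    ([:: (2, 2); (3, 3); (2, 4); (2, 3)] : seq (int * int)) /\
  `|c column1| <= n column1 /\ `|c column2| <= n column2.
Proof.
have E i : [/\ r%:Z = n i * (width C i)%:Z + c i, - (width C i)%:Z < 2 * c i &
    2 * c i <= (width C i)%:Z].
  case: (hnc i) => h1 h2 h3; split=> //.
    rewrite -(ltr_int rat) rmorphN rmorphM /= -pmulrn; lra.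
  rewrite -(ler_int rat) rmorphM /= -pmulrn; lra.
have dim_le : 3 * dimension C eps <= r%:Z - 36.
  move: (dimension C eps) hdim => D hD.
  rewrite -(ler_int rat) intrM intrB -!pmulrn; lra.
have B i : dominates_defect r%:Z (width C i)%:Z (column_defect C i).
  exact: column_defect_lower_bound.
have B0 i := column_defect_ge0 C i.
have L i : column_defect C i - (width C i)%:Z
    <= column_defect C i - eps * column_ell C i.
  by have := column_ell_bounds C i; case: heps => ->; lia.
have sum3 (R : nmodType) (F : 'I_3 -> R) :
    \sum_(i < 3) F i = F column1 + F column2 + F column3.
  rewrite !big_ord_recl big_ord0 addr0 addrA.
  by congr (_ + _ + _); congr F; exact: val_inj.
have dimE := dimension_columns C eps.
rewrite sum3 in dimE.
have := width_sum C; rewrite (sum3 nat) => hs.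
have h12 := width_ge12 C; have h23 := width_ge23 C; have h3 := width3_ge1 C.
(* The columns contribute at least -25, 5 * 10 - 15 = 35 and 0, whereas 50/3 - 12 < 10. *)
have exc : ~ ((width C column1)%:Z = 25 /\ (width C column2)%:Z = 15
    /\ (width C column3)%:Z = 10).
  case=> q1E [q2E q3E].
  have := @odd_quotient_column_ge0 r C column3 5 eps heps isT ltac:(lia) ltac:(lia).
  have := B column2 3 5 ltac:(lia) ltac:(lia).
  have := B0 column1; have := L column1; have := L column2.
  lia.
have L1 := L column1; have L2 := L column2; have L3 := L column3.
have B1 := B column1; have B2 := B column2; have B3 := B column3.
have B10 := B0 column1; have B20 := B0 column2; have B30 := B0 column3.
have [E1 E1l E1u] := E column1; have [E2 E2l E2u] := E column2.
have hb : 3 * (column_defect C column1 + column_defect C column2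
    + column_defect C column3) <= 4 * r%:Z - 36 by lia.
move: hs h12 h23 h3 exc B1 B2 B3 B10 B20 B30 E1 E1l E1u E2 E2l E2u hb.
move: (n column1) (c column1) (n column2) (c column2) => n1 c1 n2 c2.
move: (column_defect C column1) (column_defect C column2)
  (column_defect C column3) => b1 b2 b3.
move: (width C column1) (width C column2) (width C column3) => q1 q2 q3.
clear - hr => hs h12 h23 h3 exc B1 B2 B3 B10 B20 B30 E1 E1l E1u E2 E2l E2u hb.
have hrz : 48 <= r%:Z by lia.
have hsz : q1%:Z + q2%:Z + q3%:Z = r%:Z by lia.
have [n1E|n1E] := @first_quotient r q1 q2 q3 n1 c1 b1 hrz ltac:(lia) ltac:(lia)
  ltac:(lia) hsz B1 E1 ltac:(lia) ltac:(lia); subst n1; last first.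
  have c1l : -3 <= c1.
    by apply: (@quotient3_remainder_ge r q1 b1) => //; lia.
  have [-> [c1b c2b]] := @remainders_le_quotient33 r q1 q2 q3 n2 c1 c2 hrz
    ltac:(lia) ltac:(lia) hsz E1 c1l E2 ltac:(lia).
  by [].
have c1b : `|c1| <= 2.
  by apply: (@quotient2_small_remainder r q1 b1) => //; lia.
(* From (r - q1)/2 <= q2 <= q1 and q1 within 1 of r/2, q2 lies between r/4 - 1/2 and r/2 + 1. *)
have n2l : 1 < n2 by nia.
have n2u : n2 < 5 by nia.
have [n2E|[n2E|n2E]] : n2 = 2 \/ n2 = 3 \/ n2 = 4 by lia.
- subst n2; split=> //; split=> //.
  by apply: (@quotient2_small_remainder r q2 b2) => //; lia.
- subst n2; split=> //; split=> //.
  by apply: (@second_remainder_le_quotient23 r q1 q2 q3 b1 b2 b3 c1 c2) => //; lia.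
- subst n2; split=> //; split=> //.
  by apply: (@second_remainder_le_quotient24 r q1 q2 q3 b1 b2 b3 c1 c2) => //; lia.
Qed.
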